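(* Let $1<q\le2$, $\gamma>0$, and $p:=q/(q-1)$. There is a constant $C(q,\gamma)$, depending only on $q$ and $\gamma$, such that the following holds. Let $X$ be a uniformly smooth Banach space (over $\mathbb{K}=\mathbb{R}$ or $\mathbb{C}$) with modulus of smoothness $\rho(u)\le\gamma u^q$ for $u\ge 0$, let $\mathcal{D}$ be a dictionary in $X$, and let $\tau=\{t_k\}_{k=1}^\infty$, $t_k\in[0,1]$. Take a number $\varepsilon\ge0$ and two elements $f,f^\varepsilon$ from $X$ such that $$\|f-f^\varepsilon\|\le\varepsilon,\qquad f^\varepsilon/A(\varepsilon)\in A_1(\mathcal{D}),$$ with some number $A(\varepsilon)>0$. Then the residual $f_m$ after $m$ iterations ($m=1,2,\dots$) of the Weak Greedy Algorithm with Free Relaxation (WGAFR) with weakness sequence $\tau$, applied to $f$ with respect to $\mathcal{D}$ (for any realization), satisfies $$\|f_m\|\le\max\left(2\varepsilon,\; C(q,\gamma)(A(\varepsilon)+\varepsilon)\left(1+\sum_{k=1}^m t_k^p\right)^{-1/p}\right).$$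
   Context: A dictionary in a Banach space $X$ over $\mathbb{K}\in\{\mathbb{R},\mathbb{C}\}$ is a set $\mathcal{D}\subset X$ such that $\|g\|\le 1$ for each $g\in\mathcal{D}$ and the closure of $\operatorname{span}\mathcal{D}$ is $X$. $A_1(\mathcal{D})$ is the closure in $X$ of $\{\sum_{j=1}^\infty a_jg_j:\ a_j\in\mathbb{K},\ \sum_{j=1}^\infty|a_j|\le1,\ g_j\in\mathcal{D}\}$. For $F\in X^*$ put $\|F\|_{\mathcal{D}}:=\sup_{g\in\mathcal{D}}|F(g)|$. For nonzero $h\in X$, $F_h$ denotes a norming functional of $h$: $F_h\in X^*$, $\|F_h\|=1$, $F_h(h)=\|h\|$. The modulus of smoothness of $X$ is $\rho(u):=\sup_{\|x\|=\|y\|=1}\left(\frac12(\|x+uy\|+\|x-uy\|)-1\right)$ for real $u$; $X$ is uniformly smooth if $\lim_{u\to0}\rho(u)/u=0$. WGAFR with weakness sequence $\tau=\{t_m\}_{m=1}^\infty$, $t_m\in[0,1]$: set $f_0:=f$, $G_0:=0$. For each $m\ge1$: (1) $\varphi_m\in\mathcal{D}$ is any element satisfying $|F_{f_{m-1}}(\varphi_m)|\ge t_m\|F_{f_{m-1}}\|_{\mathcal{D}}$ (if $f_{m-1}=0$, $\varphi_m\in\mathcal{D}$ is arbitrary). (2) Find $w_m,\lambda_m\in\mathbb{K}$ such that $\|f-((1-w_m)G_{m-1}+\lambda_m\varphi_m)\|=\inf_{\lambda,w\in\mathbb{K}}\|f-((1-w)G_{m-1}+\lambda\varphi_m)\|$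 and define $G_m:=(1-w_m)G_{m-1}+\lambda_m\varphi_m$. (3) $f_m:=f-G_m$. A realization is any sequence of choices consistent with (1)–(3). *)

(* Defs.v *)
From HB Require Import structures.
From mathcomp Require Import all_boot all_order all_algebra complex.
From mathcomp Require Import all_classical all_reals all_analysis.
Import Order.TTheory GRing.Theory Num.Theory.
Import numFieldNormedType.Exports.

Set Implicit Arguments.
Unset Strict Implicit.
Unset Printing Implicit Defensive.

Local Open Scope classical_set_scope.
Local Open Scope ring_scope.
Local Open Scope complex_scope.

(* [scalar_field R K] is inhabited exactly when K is R or R[i]; a single
   binder [s : scalar_field R K] thus makes a statement uniform in both cases. *)
Variant scalar_field (R : realType) : numFieldType -> Type :=
| RealScalars : scalar_field R R
| ComplexScalars : scalar_field R R[i].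

Definition of_real (R : realType) (K : numFieldType) (s : scalar_field R K) :
    R -> K :=
  match s in scalar_field _ K' return R -> K' with
  | RealScalars => fun x => x
  | ComplexScalars => fun x => x%:C
  end.

Definition re_part (R : realType) (K : numFieldType) (s : scalar_field R K) :
    K -> R :=
  match s in scalar_field _ K' return K' -> R with
  | RealScalars => fun x => x
  | ComplexScalars => fun x => complex.Re x
  end.

(* The norm of a normedModType over K takes values in K. It is a nonnegative
   element of K, hence real, so taking its real part loses nothing. *)
Definition rnorm (R : realType) (K : numFieldType) (s : scalar_field R K)
  (V : normedModType K) (x : V) : R := re_part s `|x|.

Section Smoothness.
Variables (R : realType) (K : numFieldType) (s : scalar_field R K).
Variable X : normedModType K.

Definition modulus_of_smoothness (u : R) : R :=
  sup [set r : R | exists x y : X, [/\ rnorm s x = 1, rnorm s y = 1 &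
    r = 2^-1 * (rnorm s (x + of_real s u *: y) +
                rnorm s (x - of_real s u *: y)) - 1]].

Definition uniformly_smooth : Prop :=
  (fun u : R => modulus_of_smoothness u / u) @ 0^' --> (0 : R).

End Smoothness.

Section Dictionary.
Variables (R : realType) (K : numFieldType) (s : scalar_field R K).
Variable X : normedModType K.

Definition linear_span (D : set X) : set X :=
  [set x | exists (n : nat) (a : 'I_n -> K) (g : 'I_n -> X),
    (forall i, D (g i)) /\ x = \sum_(i < n) a i *: g i].

Definition dictionary (D : set X) : Prop :=
  (forall g, D g -> rnorm s g <= 1) /\ closure (linear_span D) = setT.

Definition A1 (D : set X) : set X :=
  closure [set x | exists (a : nat -> K) (g : nat -> X),
    [/\ forall j, D (g j),
        (\sum_(0 <= j <oo) (rnorm s (a j : K^o))%:E <= 1)%E &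
        series (fun j => a j *: g j) @ \oo --> x]].

Definition dual_norm (F : {linear X -> K^o}) : R :=
  sup [set rnorm s (F x) | x in [set x : X | rnorm s x <= 1]].

Definition dictionary_norm (D : set X) (F : {linear X -> K^o}) : R :=
  sup [set rnorm s (F g) | g in D].

Definition norming_functional (h : X) (F : {linear X -> K^o}) : Prop :=
  [/\ continuous F, dual_norm F = 1 & F h = of_real s (rnorm s h)].

(* Index m.+1 of phi, w, lam, G, res is the m.+1-st iteration, and F m is the
   norming functional of res m used in it; the values of phi, w, lam and t
   at 0 are irrelevant. No functional is involved once a residual vanishes. *)
Record WGAFR_realization (D : set X) (t : nat -> R) (f : X)
    (F : nat -> {linear X -> K^o}) (phi : nat -> X) (w lam : nat -> K)
    (G res : nat -> X) : Prop := {
  WGAFR_G0 : G 0%N = 0;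
  WGAFR_res0 : res 0%N = f;
  WGAFR_phi_in : forall m, D (phi m.+1);
  WGAFR_greedy : forall m, res m != 0 ->
    norming_functional (res m) (F m) /\
    t m.+1 * dictionary_norm D (F m) <= rnorm s (F m (phi m.+1));
  WGAFR_relax : forall m,
    rnorm s (f - ((1 - w m.+1) *: G m + lam m.+1 *: phi m.+1)) =
    inf [set r : R | exists l v : K,
          r = rnorm s (f - ((1 - v) *: G m + l *: phi m.+1))];
  WGAFR_GS : forall m,
    G m.+1 = (1 - w m.+1) *: G m + lam m.+1 *: phi m.+1;
  WGAFR_resS : forall m, res m.+1 = f - G m.+1 }.

End Dictionary.

(* Main.v *)
Require Import Defs.
From HB Require Import structures.
From mathcomp Require Import all_boot all_order all_algebra complex.
From mathcomp Require Import all_classical all_reals all_analysis.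
From mathcomp Require Import ring lra.
Import Order.TTheory GRing.Theory Num.Theory.
Import numFieldNormedType.Exports.

Set Implicit Arguments.
Unset Strict Implicit.
Unset Printing Implicit Defensive.

Local Open Scope classical_set_scope.
Local Open Scope ring_scope.

(** Each iteration is compared with one explicit competitor. With
    r = res m, a = |r| and B = A + eps, the competitor moves r to r - h for
    h = l phi - v G, where l and v are small multiples of A and of the weakness
    parameter t, in a ratio fixed by the following computation. The norming
    functional F of r satisfies |F phi| >= t sup_D |F|, and sup_D |F| controls F
    on A1, hence on feps / A; as feps is eps-close to f = r + G, this gives
      Re F h >= mu t (a - eps)        for a free parameter mu >= 0.
    So |r + h| >= Re F (r + h) is large, and the modulus of smoothness, which
    bounds |r + h| + |r - h|, forces |r - h| to be small
    (relaxed_competitor):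
      |res m.+1| <= a (1 + 2 gamma (3 mu B / a)^q) - mu t (a - eps).
    The factor 3 B comes from |G| <= 2 |f| <= 2 B, because residuals never
    increase.

    Once some residual is at most 2 eps, monotonicity settles the claim.
    While a > 2 eps, a - eps >= a / 2, and choosing mu so that the smoothness
    term eats half of the gain (balanced_step) leaves, for b_m = |res m| / B,
      b_(m+1) <= b_m (1 - c t^p b_m^p)
    with c depending only on q and gamma. Such a recursion makes
    b_m^p (1 + c sum_(k <= m) t_k^p) <= 1 an invariant (decay_step), starting
    from |f| <= B; solving it for b_m is the stated rate (decay_rate), with
    C = min(1, c)^(-1/p). *)

(** * Scalars: the real and the complex case at once *)

Section Scalars.
Variables (R : realType) (K : numFieldType) (s : scalar_field R K).

Lemma of_realD x y : of_real s (x + y) = of_real s x + of_real s y.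
Proof. by case: s => //=; rewrite rmorphD. Qed.

Lemma of_realM x y : of_real s (x * y) = of_real s x * of_real s y.
Proof. by case: s => //=; rewrite rmorphM. Qed.

Lemma of_real_inv x : of_real s x^-1 = (of_real s x)^-1.
Proof. by case: s => //=; rewrite fmorphV. Qed.

Lemma of_real0 : of_real s 0 = 0.
Proof. by case: s. Qed.

Lemma of_real1 : of_real s 1 = 1.
Proof. by case: s. Qed.

Lemma ler_of_real x y : (of_real s x <= of_real s y) = (x <= y).
Proof. by case: s => //=; rewrite lecR. Qed.

Lemma ltr_of_real x y : (of_real s x < of_real s y) = (x < y).
Proof. by case: s => //=; rewrite ltcR. Qed.

Lemma of_realK : cancel (of_real s) (re_part s).
Proof. by case: s. Qed.

Lemma re_partK (z : K) : 0 <= z -> of_real s (re_part s z) = z.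
Proof.
by case: s z => //= z z0; apply/RRe_real/ger0_real.
Qed.

Lemma re_partD x y : re_part s (x + y) = re_part s x + re_part s y.
Proof. by case: s x y => //= x y; rewrite raddfD. Qed.

Lemma re_partN x : re_part s (- x) = - re_part s x.
Proof. by case: s x => //= x; rewrite raddfN. Qed.

Lemma re_partZ c x : re_part s (of_real s c * x) = c * re_part s x.
Proof. by case: s x => //= -[a b] /=; rewrite mul0r subr0. Qed.

Lemma re_part_le_norm x : re_part s x <= re_part s `|x|.
Proof.
case: s x => [x|[a b]]; first exact: ler_norm.
rewrite (normc_def (a +i* b)%C) /=.
apply: (le_trans (ler_norm _)); rewrite -sqrtr_sqr ler_wsqrtr//.
by rewrite lerDl sqr_ge0.
Qed.

Lemma norm_of_real c : 0 <= c -> `|of_real s c| = of_real s c.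
Proof. by move=> c0; rewrite ger0_norm// -of_real0 ler_of_real. Qed.

End Scalars.

(** * The real-valued norm *)

Section RealNorm.
Variables (R : realType) (K : numFieldType) (s : scalar_field R K).
Variable X : normedModType K.
Implicit Types x y : X.

Lemma of_real_rnorm x : of_real s (rnorm s x) = `|x|.
Proof. exact: re_partK. Qed.

Lemma rnorm_le_of_real x c : (rnorm s x <= c) = (`|x| <= of_real s c).
Proof. by rewrite -(ler_of_real s) of_real_rnorm. Qed.

Lemma rnorm_ge0 x : 0 <= rnorm s x.
Proof. by rewrite -(ler_of_real s) of_real_rnorm of_real0. Qed.

Lemma rnorm0 : rnorm s (0 : X) = 0.
Proof. by rewrite /rnorm normr0 -(of_real0 s) of_realK. Qed.

Lemma rnorm_eq0 x : (rnorm s x == 0) = (x == 0).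
Proof.
apply/eqP/eqP => [x0|->]; last exact: rnorm0.
by apply/eqP; rewrite -normr_eq0 -of_real_rnorm x0 of_real0.
Qed.

Lemma rnorm_gt0 x : (0 < rnorm s x) = (x != 0).
Proof. by rewrite lt_def rnorm_eq0 rnorm_ge0 andbT. Qed.

Lemma rnormD x y : rnorm s (x + y) <= rnorm s x + rnorm s y.
Proof.
by rewrite rnorm_le_of_real of_realD !of_real_rnorm ler_normD.
Qed.

Lemma rnormN x : rnorm s (- x) = rnorm s x.
Proof. by rewrite /rnorm normrN. Qed.

Lemma rnormB x y : rnorm s (x - y) <= rnorm s x + rnorm s y.
Proof. by rewrite -(rnormN y) rnormD. Qed.

Lemma rnormZ (c : K) x : rnorm s (c *: x) = rnorm s (c : K^o) * rnorm s x.
Proof.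
apply: (can_inj (of_realK s)).
by rewrite of_realM /rnorm !re_partK// normrZ.
Qed.

Lemma rnorm_of_real c : 0 <= c -> rnorm s (of_real s c : K^o) = c.
Proof. by move=> c0; rewrite /rnorm norm_of_real// of_realK. Qed.

Lemma rnormZ_of_real c x : 0 <= c ->
  rnorm s (of_real s c *: x) = c * rnorm s x.
Proof. by move=> c0; rewrite rnormZ rnorm_of_real. Qed.

Lemma rnorm_sum (I : Type) (r : seq I) (h : I -> X) :
  rnorm s (\sum_(i <- r) h i) <= \sum_(i <- r) rnorm s (h i).
Proof.
apply: (big_ind2 (fun (a : X) (b : R) => rnorm s a <= b)) => [|a b c d ab cd|//].
  by rewrite rnorm0.
by apply: (le_trans (rnormD _ _)); apply: lerD.
Qed.

End RealNorm.

(** Multiplying phi by such a phase c turns |F phi| into Re F (c phi), so that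
    lower bounds on |F phi| become lower bounds on a real part. *)
Lemma exists_phase (R : realType) (K : numFieldType)
    (s : scalar_field R K) (z : K) :
  exists2 c : K, rnorm s (c : K^o) <= 1 & c * z = of_real s (rnorm s (z : K^o)).
Proof.
have [->|z0] := eqVneq z 0.
  exists 0; first by rewrite (@rnorm0 _ _ s K^o).
  by rewrite mulr0 (@rnorm0 _ _ s K^o) of_real0.
exists (`|z| / z); last by rewrite (@of_real_rnorm _ _ s K^o) divfK.
rewrite (@rnorm_le_of_real _ _ s K^o) of_real1.
by rewrite /= normrM normr_id normfV divff// normr_eq0.
Qed.

(** * Functionals on the dictionary and on A1 *)

Section Functionals.
Variables (R : realType) (K : numFieldType) (s : scalar_field R K).
Variable X : normedModType K.
Implicit Types (F : {linear X -> K^o}) (D : set X) (x y g : X).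

(** The dual norm is a genuine supremum here: its value 1 differs from the
    default value 0 of sup, so the values of F on the unit ball are bounded and
    the usual estimate by homogeneity holds. *)
Lemma norming_functional_le h F x :
  norming_functional s h F -> rnorm s (F x) <= rnorm s x.
Proof.
case=> _ F1 _.
have Fsup : has_sup [set rnorm s (F x) | x in [set x : X | rnorm s x <= 1]].
  apply: contrapT => /sup_out; rewrite -/(dual_norm s F) F1 => /eqP.
  by rewrite oner_eq0.
have [->|x0] := eqVneq x 0; first by rewrite linear0 !rnorm0.
have nx : 0 < rnorm s x by rewrite rnorm_gt0.
have : rnorm s (F (of_real s (rnorm s x)^-1 *: x)) <= 1.
  rewrite -F1; apply: sup_upper_bound => //.
  exists (of_real s (rnorm s x)^-1 *: x) => //=.
  by rewrite rnormZ_of_real ?invr_ge0 ?(ltW nx)// mulVf ?(gt_eqF nx).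
rewrite linearZ/= rnormZ_of_real ?invr_ge0 ?(ltW nx)//.
by rewrite mulrC ler_pdivrMr// mul1r.
Qed.

Lemma le_dictionary_norm D F g : dictionary s D ->
  (forall x, rnorm s (F x) <= rnorm s x) -> D g ->
  rnorm s (F g) <= dictionary_norm s D F.
Proof.
move=> [D1 _] Fle Dg; apply: ub_le_sup; last by exists g.
by exists 1 => _ [x Dx <-]; apply: (le_trans (Fle x)); apply: D1.
Qed.

(** Finite sums suffice to describe the closure: the series are limits of their
    partial sums, whose coefficients still have total mass at most 1. *)
Lemma A1_finite_approx D x (e : R) : A1 s D x -> 0 < e ->
  exists n (a : nat -> K) (g : nat -> X), [/\ forall j, D (g j),
    \sum_(0 <= j < n) rnorm s (a j : K^o) <= 1 &
    rnorm s (x - \sum_(0 <= j < n) a j *: g j) <= e].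
Proof.
move=> Ax e0.
have e20 : 0 < of_real s (e / 2).
  by rewrite -(of_real0 s) ltr_of_real divr_gt0.
have [y [[a [g [Dg a1 cvg]]] xy]] := Ax _ (nbhsx_ballx x _ e20).
have /cvgrPdist_lt/(_ _ e20)[n _ /(_ n (leqnn n))/= yn] := cvg.
exists n, a, g; split => //.
  rewrite -lee_fin -sumEFin; apply: le_trans a1.
  by apply: nneseries_lim_ge => j _ _; rewrite lee_fin rnorm_ge0.
have -> : x - \sum_(0 <= j < n) a j *: g j =
  (x - y) + (y - \sum_(0 <= j < n) a j *: g j) by rewrite addrA subrK.
apply: (le_trans (rnormD s _ _)); rewrite [leRHS]splitr lerD//.
  by rewrite rnorm_le_of_real; move: xy; rewrite -ball_normE; exact: ltW.
by rewrite rnorm_le_of_real ltW.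
Qed.

(** A bound on the dictionary passes to A1 by convexity and density. It serves
    twice: for a norming functional, and for the identity, where it says that
    A1 lies in the unit ball. *)
Lemma A1_linear_bound (Y : normedModType K) (T : {linear X -> Y}) (M : R) D x :
  (forall y, rnorm s (T y) <= rnorm s y) -> 0 <= M ->
  (forall g, D g -> rnorm s (T g) <= M) -> A1 s D x -> rnorm s (T x) <= M.
Proof.
move=> Tle M0 TM Ax; apply/ler_addgt0Pr => e e0.
have [n [a [g [Dg a1 xe]]]] := A1_finite_approx Ax e0.
rewrite -[x](subrK (\sum_(0 <= j < n) a j *: g j)) linearD/= addrC.
apply: (le_trans (rnormD s _ _)); rewrite lerD//; last exact: le_trans xe.
rewrite linear_sum; apply: (le_trans (rnorm_sum s _ _)).
apply: (@le_trans _ _ (\sum_(0 <= j < n) rnorm s (a j : K^o) * M)).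
  apply: ler_sum => j _; rewrite linearZ/= rnormZ ler_wpM2l ?rnorm_ge0//.
  exact: TM.
by rewrite -mulr_suml ler_piMl.
Qed.

End Functionals.

(** * The smoothness inequality *)

Section SmoothnessInequality.
Variables (R : realType) (K : numFieldType) (s : scalar_field R K).
Variable X : normedModType K.

(** The supremum in the modulus is finite, being at most u by the triangle
    inequality; hence it does dominate each of its members. *)
Lemma modulus_of_smoothness_ge (u : R) (x y : X) : 0 <= u ->
  rnorm s x = 1 -> rnorm s y = 1 ->
  rnorm s (x + of_real s u *: y) + rnorm s (x - of_real s u *: y) <=
  2 * (1 + modulus_of_smoothness s X u).
Proof.
move=> u0 x1 y1.
suff : 2^-1 * (rnorm s (x + of_real s u *: y) +
    rnorm s (x - of_real s u *: y)) - 1 <= modulus_of_smoothness s X u by lra.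
apply: ub_le_sup; last by exists x, y.
exists u => _ [a [b [a1 b1 ->]]].
have := rnormD s a (of_real s u *: b); have := rnormB s a (of_real s u *: b).
rewrite rnormZ_of_real// a1 b1; lra.
Qed.

(** The bound on the modulus in homogeneous form: rescale x and y to unit
    vectors, with u the ratio of their norms. *)
Lemma smooth_parallelogram (q gamma : R) (x y : X) : 0 <= gamma ->
  (forall u, 0 <= u -> modulus_of_smoothness s X u <= gamma * u `^ q) ->
  x != 0 ->
  rnorm s (x + y) + rnorm s (x - y) <=
  2 * rnorm s x * (1 + gamma * (rnorm s y / rnorm s x) `^ q).
Proof.
move=> g0 rhole x0; have nx : 0 < rnorm s x by rewrite rnorm_gt0.
have [->|y0] := eqVneq y 0.
  rewrite subr0 addr0 -mulr2n -[_ *+ 2]mulr_natl ler_peMr//.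
    by rewrite mulr_ge0// rnorm_ge0.
  by rewrite lerDl mulr_ge0// powR_ge0.
have ny : 0 < rnorm s y by rewrite rnorm_gt0.
have unit z : 0 < rnorm s z -> rnorm s (of_real s (rnorm s z)^-1 *: z : X) = 1.
  by move=> nz; rewrite rnormZ_of_real ?invr_ge0 ?(ltW nz)// mulVf ?(gt_eqF nz).
have scale z : z = of_real s (rnorm s x) *: (of_real s (rnorm s x)^-1 *: z) :> X.
  by rewrite scalerA -of_realM divff ?gt_eqF// of_real1 scale1r.
have u0 : 0 <= rnorm s y / rnorm s x by rewrite divr_ge0 ?ltW.
have := modulus_of_smoothness_ge u0 (unit _ nx) (unit _ ny).
rewrite scalerA -of_realM mulrAC divff ?gt_eqF// mul1r -scalerDr -scalerBr.
rewrite !rnormZ_of_real ?invr_ge0 ?(ltW nx)// => le1.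
have := rhole _ u0; set r := rnorm s (x + y) in le1 *.
set r' := rnorm s (x - y) in le1 *.
move=> le2; have : (rnorm s x)^-1 * (r + r') <=
    2 * (1 + gamma * (rnorm s y / rnorm s x) `^ q) by rewrite mulrDr; lra.
by rewrite ler_pdivrMl// mulrCA mulrA.
Qed.

End SmoothnessInequality.

(** * One greedy step *)

Section GreedyStep.
Variables (R : realType) (K : numFieldType) (s : scalar_field R K).
Variable X : normedModType K.
Variables (q gamma : R).
Hypothesis gamma_ge0 : 0 <= gamma.
Hypothesis q_ge0 : 0 <= q.
Hypothesis rho_le : forall u : R, 0 <= u ->
  modulus_of_smoothness s X u <= gamma * u `^ q.
Variable D : set X.
Hypothesis dictD : dictionary s D.

(** The competitor shrinks G by the factor 1 - mu t and adds phi, rotated by a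
    phase, with weight mu A. This ratio of weights makes the greedy gain
    mu A |F phi| >= mu t Re F feps dominate the loss mu t Re F G, and
    F (f - G) = |f - G| bounds the difference below by mu t (|f - G| - eps). *)
Lemma relaxed_competitor (t eps A mu : R) (f feps G phi : X)
    (F : {linear X -> K^o}) :
  0 <= t <= 1 -> 0 < A -> 0 <= mu ->
  rnorm s (f - feps) <= eps -> A1 s D ((of_real s A)^-1 *: feps) ->
  rnorm s G <= 2 * (A + eps) -> f - G != 0 ->
  norming_functional s (f - G) F ->
  D phi -> t * dictionary_norm s D F <= rnorm s (F phi) ->
  exists l v : K, rnorm s (f - ((1 - v) *: G + l *: phi)) <=
    rnorm s (f - G) *
      (1 + 2 * gamma * (3 * mu * (A + eps) / rnorm s (f - G)) `^ q) -
    mu * t * (rnorm s (f - G) - eps).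
Proof.
move=> /andP[t0 t1] A0 mu0 feps_near feps_A1 G_le r0 Fnorm Dphi greedy.
have eps0 : 0 <= eps by apply: le_trans feps_near; exact: rnorm_ge0.
have Fle x : rnorm s (F x) <= rnorm s x := norming_functional_le x Fnorm.
have Fr : F (f - G) = of_real s (rnorm s (f - G)) by case: Fnorm.
have reF_le x : re_part s (F x) <= rnorm s (F x) := re_part_le_norm s _.
set r := f - G in r0 Fr *.
have nr : 0 < rnorm s r by rewrite rnorm_gt0.
have [c c1 cphi] := exists_phase s (F phi).
set l : K := of_real s (mu * A) * c.
set v : K := of_real s (mu * t).
exists l, v; set h := l *: phi - v *: G.
have -> : f - ((1 - v) *: G + l *: phi) = r - h.
  by rewrite /r /h scalerBl scale1r !opprD !opprK !addrA addrAC.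
have mut : 0 <= mu * t by rewrite mulr_ge0.
have muA : 0 <= mu * A by rewrite mulr_ge0// ltW.
(* mu A from phi and 2 mu (A + eps) from G *)
have h_le : rnorm s h <= 3 * mu * (A + eps).
  apply: (le_trans (rnormB _ _ _)).
  rewrite rnormZ_of_real// /l -scalerA rnormZ_of_real// rnormZ.
  have cphi1 : rnorm s (c : K^o) * rnorm s phi <= 1.
    by rewrite mulr_ile1 ?rnorm_ge0//; apply: dictD.1.
  have : mu * A * (rnorm s (c : K^o) * rnorm s phi) <= mu * A by rewrite ler_piMr.
  have : mu * t * rnorm s G <= mu * (2 * (A + eps)).
    rewrite -mulrA ler_wpM2l// (le_trans _ G_le)//.
    by rewrite ler_piMl// rnorm_ge0.
  have : 0 <= mu * eps by rewrite mulr_ge0.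
  lra.
have reFh : mu * t * (rnorm s r - eps) <= re_part s (F h).
  have -> : re_part s (F h) =
      mu * A * rnorm s (F phi) - mu * t * re_part s (F G).
    have Fl : F (l *: phi) = of_real s (mu * A * rnorm s (F phi)).
      by rewrite of_realM -cphi linearZ mulrA.
    have Fv : re_part s (F (v *: G)) = mu * t * re_part s (F G).
      by rewrite linearZ; exact: re_partZ.
    by rewrite /h linearB re_partD re_partN Fl of_realK Fv.
  have M0 : 0 <= dictionary_norm s D F.
    by apply: le_trans (le_dictionary_norm dictD Fle Dphi); exact: rnorm_ge0.
  have feps_le : re_part s (F feps) <= A * dictionary_norm s D F.
    have := A1_linear_bound Fle M0 (fun g => le_dictionary_norm dictD Fle) feps_A1.
    rewrite -of_real_inv linearZ rnormZ_of_real ?invr_ge0 ?(ltW A0)//.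
    by rewrite ler_pdivrMl//; apply: le_trans.
  have f_le : re_part s (F f) <= re_part s (F feps) + eps.
    rewrite -[f](subrK feps) addrC linearD re_partD lerD2l.
    by apply: (le_trans (reF_le _)); apply: (le_trans (Fle _)).
  have r_eq : rnorm s r = re_part s (F f) - re_part s (F G).
    by rewrite -(of_realK s (rnorm s r)) -Fr /r linearB re_partD re_partN.
  have : mu * A * (t * dictionary_norm s D F) <= mu * A * rnorm s (F phi).
    by rewrite ler_wpM2l.
  have : mu * t * re_part s (F f) <= mu * t * (A * dictionary_norm s D F + eps).
    by rewrite ler_wpM2l//; lra.
  rewrite r_eq; lra.
have lower : rnorm s r + mu * t * (rnorm s r - eps) <= rnorm s (r + h).
  apply: (@le_trans _ _ (re_part s (F (r + h)))).
    by rewrite linearD re_partD Fr of_realK lerD2l.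
  by apply: (le_trans (reF_le _)).
have := smooth_parallelogram h gamma_ge0 rho_le r0.
have : gamma * (rnorm s h / rnorm s r) `^ q <=
    gamma * (3 * mu * (A + eps) / rnorm s r) `^ q.
  rewrite ler_wpM2l// ge0_ler_powR// ?nnegrE ?divr_ge0 ?rnorm_ge0//.
    by rewrite !mulr_ge0// addr_ge0// ltW.
  by rewrite ler_pM2r// invr_gt0.
move/(ler_wpM2l (ltW nr)); lra.
Qed.

End GreedyStep.

(** * Choice of the step and the resulting rate *)

Section StepSize.
Variables (R : realType) (q gamma : R).
Hypothesis q_gt1 : 1 < q.
Hypothesis gamma_gt0 : 0 < gamma.

(** The positive solution k of 8 gamma 3^q k^q = k, which is what
    balanced_step needs. *)
Definition gain_constant : R := (8 * gamma * 3 `^ q) `^ (- (q - 1)^-1).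

Lemma conjugate_gt1 : 1 < q / (q - 1).
Proof. by rewrite ltr_pdivlMr ?subr_gt0// mul1r gtrBl. Qed.

Lemma conjugateB1 : q / (q - 1) - 1 = (q - 1)^-1.
Proof. by field; rewrite subr_eq0 gt_eqF. Qed.

Lemma gain_constant_gt0 : 0 < gain_constant.
Proof. by rewrite powR_gt0// !mulr_gt0// powR_gt0. Qed.

Lemma gain_constantXq :
  8 * gamma * 3 `^ q * gain_constant `^ q = gain_constant.
Proof.
have c0 : 0 < 8 * gamma * 3 `^ q by rewrite !mulr_gt0// powR_gt0.
rewrite -(@mulr_powRB1 _ gain_constant q) ?(ltW gain_constant_gt0)//; last first.
  exact: lt_trans ltr01 q_gt1.
rewrite {2}/gain_constant -powRrM.
have -> : - (q - 1)^-1 * (q - 1) = -1 by field; rewrite subr_eq0 gt_eqF.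
by rewrite powR_inv1 ?(ltW c0)//; field; rewrite !gt_eqF// powR_gt0.
Qed.

(** Here b stands for |res m| / (A + eps). The smoothness cost is of order
    (mu / b)^q and the gain of order mu t, so equating them up to a constant
    forces mu to be a multiple of t^(p-1) b^p, as (p - 1) q = p. The factor
    1/4 leaves 1/2 - 1/4 of the gain mu t when |res m| > 2 eps. *)
Lemma balanced_step (t b : R) : 0 <= t -> 0 < b ->
  let p := q / (q - 1) in
  let mu := gain_constant * t `^ (p - 1) * b `^ p in
  2 * gamma * (3 * mu / b) `^ q = mu * t / 4 /\
  mu * t = gain_constant * t `^ p * b `^ p.
Proof.
move=> t0 b0 p mu.
have p1 : 1 < p := conjugate_gt1.
have pq : (p - 1) * q = p by rewrite /p conjugateB1 mulrC.
clearbody p.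
have c0 := ltW gain_constant_gt0.
have mut : mu * t = gain_constant * t `^ p * b `^ p.
  by rewrite -(@mulr_powRB1 _ t p)// /mu; [ring | lra].
split=> //; rewrite mut.
have -> : 3 * mu / b = 3 * gain_constant * t `^ (p - 1) * b `^ (p - 1).
  rewrite /mu -(@mulr_powRB1 _ b p) ?(ltW b0)//; last lra.
  by field; rewrite gt_eqF.
rewrite !powRM ?mulr_ge0 ?powR_ge0//.
rewrite -[(t `^ _) `^ q]powRrM -[(b `^ _) `^ q]powRrM pq.
rewrite -[in RHS]gain_constantXq.
set k := gain_constant `^ q; set z := 3 `^ q.
by field.
Qed.

End StepSize.

Section Rate.
Variables (R : realType) (p : R).
Hypothesis p_gt1 : 1 < p.

(** With y = b^p and d = c t^p, the inequality (1 - d y)^p <= 1 - d y gives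
    a^p (S + d) <= (1 - d y) (y S + d y) <= (1 - d y) (1 + d y) <= 1.
    Stated with a product, not with b^(-p), to cover b = 0. *)
Lemma decay_step (c t a b S : R) : 0 <= c -> 0 <= t -> 0 <= a -> 0 <= b ->
  a <= b * (1 - c * t `^ p * b `^ p) -> b `^ p * S <= 1 -> 0 <= S ->
  a `^ p * (S + c * t `^ p) <= 1.
Proof.
move=> c0 t0 a0 b0 ab bS S0; have p1 := p_gt1.
set d := c * t `^ p in ab *; set y := b `^ p in ab bS *.
have d0 : 0 <= d by rewrite mulr_ge0// powR_ge0.
have y0 : 0 <= y by rewrite powR_ge0.
have [b_eq0|b_neq0] := eqVneq b 0.
  have -> : a = 0 by apply/eqP; rewrite eq_le a0 andbT (le_trans ab)// b_eq0 mul0r.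
  by rewrite powR0 ?mul0r//; lra.
have bpos : 0 < b by rewrite lt_def b_neq0.
have x0 : 0 <= 1 - d * y by rewrite -(pmulr_rge0 _ bpos) (le_trans a0).
have x1 : (1 - d * y) `^ p <= 1 - d * y.
  have [->|x_neq0] := eqVneq (1 - d * y) 0; first by rewrite powR0//; lra.
  rewrite ge1r_powR ?(ltW p_gt1)// lt_def x_neq0 x0/=.
  by rewrite gerBl mulr_ge0.
have ap : a `^ p <= y * (1 - d * y).
  apply: (@le_trans _ _ ((b * (1 - d * y)) `^ p)).
    by rewrite ge0_ler_powR ?nnegrE ?mulr_ge0//; lra.
  by rewrite powRM// ler_wpM2l.
apply: (@le_trans _ _ (y * (1 - d * y) * (S + d))).
  by rewrite ler_wpM2r// addr_ge0.
have : (1 - d * y) * (y * S + d * y) <= (1 - d * y) * (1 + d * y).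
  by rewrite ler_wpM2l// lerD2r.
have := sqr_ge0 (d * y); rewrite expr2; lra.
Qed.

(** The minimum of 1 and c is a constant k with k (1 + S) <= 1 + c S, which
    separates the constant from the sum. *)
Lemma decay_rate (c b S : R) : 0 < c -> 0 <= b -> 0 <= S ->
  b `^ p * (1 + c * S) <= 1 ->
  b <= Num.min 1 c `^ (- p^-1) * (1 + S) `^ (- p^-1).
Proof.
move=> c0 b0 S0 bS; have p1 := p_gt1.
have pp : 0 < p by lra.
set k := Num.min 1 c.
have k0 : 0 < k by rewrite lt_min ltr01.
have kS : k * (1 + S) <= 1 + c * S.
  by rewrite mulrDr mulr1 lerD ?ge_min ?lexx// ler_wpM2r// ge_min lexx orbT.
have kS0 : 0 < k * (1 + S) by rewrite mulr_gt0//; lra.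
rewrite -powRM ?(ltW k0)//; last lra.
have -> : b = (b `^ p) `^ p^-1.
  by rewrite -powRrM divff ?gt_eqF// powRr1.
have -> : (k * (1 + S)) `^ (- p^-1) = ((k * (1 + S))^-1) `^ p^-1.
  by rewrite -(powR_inv1 (ltW kS0)) -powRrM mulN1r.
rewrite ge0_ler_powR ?nnegrE ?invr_ge0 ?powR_ge0 ?(ltW pp) ?(ltW kS0)//.
rewrite -[leRHS]mul1r ler_pdivlMr//; apply: le_trans bS.
by rewrite ler_wpM2l ?powR_ge0.
Qed.

End Rate.

(** * Monotonicity of the residuals *)

Section Realization.
Variables (R : realType) (K : numFieldType) (s : scalar_field R K).
Variable X : normedModType K.
Variables (D : set X) (t : nat -> R) (f : X) (F : nat -> {linear X -> K^o}).
Variables (phi : nat -> X) (w lam : nat -> K) (G res : nat -> X).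
Hypothesis real : WGAFR_realization s D t f F phi w lam G res.

Lemma WGAFR_resE m : res m = f - G m.
Proof.
case: m => [|m]; last exact: (WGAFR_resS real).
by rewrite (WGAFR_res0 real) (WGAFR_G0 real) subr0.
Qed.

(** The set of competing norms is bounded below by 0, so its infimum, which the
    step attains, is below each of its members. *)
Lemma WGAFR_optimal m (l v : K) :
  rnorm s (res m.+1) <= rnorm s (f - ((1 - v) *: G m + l *: phi m.+1)).
Proof.
rewrite WGAFR_resE (WGAFR_GS real) (WGAFR_relax real).
apply: ge_inf; last by exists l, v.
by exists 0 => _ [l' [v' ->]]; exact: rnorm_ge0.
Qed.

(** Keeping G m unchanged, l = v = 0, is always allowed. *)
Lemma WGAFR_nonincreasing m : rnorm s (res m.+1) <= rnorm s (res m).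
Proof.
have := WGAFR_optimal m 0 0.
by rewrite subr0 scale1r scale0r addr0 -WGAFR_resE.
Qed.

Lemma WGAFR_res_le m : rnorm s (res m) <= rnorm s f.
Proof.
elim: m => [|m IH]; first by rewrite (WGAFR_res0 real).
exact: le_trans (WGAFR_nonincreasing m) IH.
Qed.

Lemma WGAFR_G_le m : rnorm s (G m) <= 2 * rnorm s f.
Proof.
have -> : G m = f - res m by rewrite WGAFR_resE opprB addrC subrK.
have := rnormB s f (res m); have := WGAFR_res_le m; lra.
Qed.

End Realization.

(** * The convergence rate *)

Theorem theorem3p2 (R : realType) (q gamma : R) :
  1 < q -> q <= 2 -> 0 < gamma ->
  let p := q / (q - 1) in
  exists C : R,
  forall (K : numFieldType) (s : scalar_field R K)
         (X : completeNormedModType K),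
  uniformly_smooth s X ->
  (forall u : R, 0 <= u -> modulus_of_smoothness s X u <= gamma * u `^ q) ->
  forall (D : set X), dictionary s D ->
  forall (t : nat -> R), (forall k, (1 <= k)%N -> 0 <= t k <= 1) ->
  forall (eps A : R) (f feps : X),
  0 <= eps -> 0 < A ->
  rnorm s (f - feps) <= eps ->
  A1 s D ((of_real s A)^-1 *: feps) ->
  forall (F : nat -> {linear X -> K^o}) (phi : nat -> X) (w lam : nat -> K)
         (G res : nat -> X),
  WGAFR_realization s D t f F phi w lam G res ->
  forall m : nat, (1 <= m)%N ->
  rnorm s (res m) <=
    Num.max (2 * eps)
      (C * (A + eps) * (1 + \sum_(1 <= k < m.+1) t k `^ p) `^ (- p^-1)).
Proof.
move=> q1 _ gamma0 p; pose c := gain_constant q gamma / 4.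
have p1 : 1 < p := conjugate_gt1 q1.
have p0 : 0 <= p by rewrite ltW// (lt_trans ltr01).
have c0 : 0 < c by rewrite divr_gt0// gain_constant_gt0.
exists (Num.min 1 c `^ (- p^-1)).
move=> K s X _ rho_le D dictD t t01 eps A f feps eps0 A0 near inA1.
move=> F phi w lam G res real m _; set B := A + eps.
have B0 : 0 < B by rewrite ltr_wpDr.
(* |feps| <= A because A1 lies in the unit ball *)
have f_le : rnorm s f <= B.
  rewrite -[f](subrK feps) addrC (le_trans (rnormD _ _ _))// lerD//.
  have := @A1_linear_bound _ _ s _ _ idfun 1 D _ (fun=> lexx _) ler01 dictD.1 inA1.
  rewrite /= -of_real_inv rnormZ_of_real ?invr_ge0 ?(ltW A0)//.
  by rewrite ler_pdivrMl// mulr1.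
pose S n := \sum_(1 <= k < n.+1) t k `^ p.
have S0 n : 0 <= S n by apply: sumr_ge0 => k _; exact: powR_ge0.
have SS n : S n.+1 = S n + t n.+1 `^ p by rewrite /S big_nat_recr.
(* the first alternative persists by monotonicity, so the recursion is only
   needed while residuals exceed 2 eps *)
have [small|potential] : rnorm s (res m) <= 2 * eps \/
    (rnorm s (res m) / B) `^ p * (1 + c * S m) <= 1; last first.
- rewrite le_max; apply/orP; right.
  have := decay_rate p1 c0 (divr_ge0 (rnorm_ge0 s _) (ltW B0)) (S0 m) potential.
  by rewrite ler_pdivrMr// mulrAC.
- by rewrite le_max small.
elim: m => [|m [small|potential]].
- right; rewrite /S big_geq// mulr0 addr0 mulr1.
  apply: (@le_trans _ _ (1 `^ p)); last by rewrite powR1.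
  rewrite (ge0_ler_powR p0) ?nnegrE ?divr_ge0 ?rnorm_ge0 ?(ltW B0)//.
  by rewrite ler_pdivrMr// mul1r (WGAFR_res0 real).
- by left; exact: le_trans (WGAFR_nonincreasing real m) small.
have [small|large] := leP (rnorm s (res m)) (2 * eps).
  by left; exact: le_trans (WGAFR_nonincreasing real m) small.
right; set a := rnorm s (res m) in potential large *.
have a0 : 0 < a by apply: le_lt_trans large; rewrite mulr_ge0.
have b0 : 0 < a / B by rewrite divr_gt0.
have res_neq0 : res m != 0 by rewrite -(rnorm_gt0 s).
have tm := t01 m.+1 isT; have /andP[t0 _] := tm.
have [Fnorm greedy] := WGAFR_greedy real res_neq0.
pose mu := gain_constant q gamma * t m.+1 `^ (p - 1) * (a / B) `^ p.
have mu0 : 0 <= mu.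
  by rewrite !mulr_ge0 ?powR_ge0// ltW// gain_constant_gt0.
have [balance mut] := balanced_step q1 gamma0 t0 b0.
rewrite -/p -/mu in balance mut.
have G_le : rnorm s (G m) <= 2 * B.
  by apply: le_trans (WGAFR_G_le real m) _; rewrite ler_pM2l.
have q0 : 0 <= q by rewrite ltW// (lt_trans ltr01).
rewrite (WGAFR_resE real) in res_neq0 Fnorm.
have [l [v]] := relaxed_competitor (ltW gamma0) q0 rho_le dictD tm A0 mu0
  near inA1 G_le res_neq0 Fnorm (WGAFR_phi_in real m) greedy.
rewrite -(WGAFR_resE real) -/a -/B.
have -> : 3 * mu * B / a = 3 * mu / (a / B) by rewrite invf_div [RHS]mulrA.
rewrite balance => /(le_trans (WGAFR_optimal real m l v)) step.
rewrite SS (mulrDr c) addrA.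
apply: (decay_step p1 (ltW c0) t0 _ (ltW b0) _ potential).
- by rewrite divr_ge0 ?rnorm_ge0 ?(ltW B0).
- rewrite mulrAC ler_wpM2r ?invr_ge0 ?(ltW B0)//; apply: (le_trans step).
  have -> : c * t m.+1 `^ p * (a / B) `^ p = mu * t m.+1 / 4.
    by rewrite mut /c; ring.
  (* a > 2 eps keeps half of the gain: a - eps >= a / 2 *)
  have : 0 <= mu * t m.+1 * (a / 2 - eps).
    by apply: mulr_ge0; [exact: mulr_ge0 | lra].
  lra.
- by rewrite addr_ge0// mulr_ge0// ltW.
Qed.
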